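(* Fix $w\in\widetilde W$. The elements $\kappa\in\widehat T(\mathbb C)$ relevant to $w$ form a closed subgroup $S_w$ of $\widehat T(\mathbb C)$ (called the relevant subgroup).
   Context: $G$ is a split connected reductive group (with connected center) over a non-archimedean local field $F$, with split maximal torus $T$ and finite Weyl group $W$; $\widehat T$ is the dual torus over $\mathbb C$, with $X^*(\widehat T)=X_*(T)$. $W$ acts on $\widehat T(\mathbb C)$ compatibly with its action on $X_*(T)$, i.e. $(\bar w\nu)(\kappa)=\nu(\bar w^{-1}\kappa)$. $\widetilde W=X_*(T)\rtimes W$ is the extended affine Weyl group, and $w\in\widetilde W$ is written uniquely $w=t_\lambda\bar w$ with $\lambda\in X_*(T)=X^*(\widehat T)$ and $\bar w\in W$. An element $\kappa\in\widehat T(\mathbb C)$ is relevant to $w=t_\lambda\bar w$ if $\bar w\kappa=\kappa$ and $\lambda(\kappa)=1$. Closed means Zariski closed. *)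

(* Defs.v *)
From HB Require Import structures.
From mathcomp Require Import all_boot all_order all_algebra.
From mathcomp Require Import boolp classical_sets reals complex mpoly.
Set Implicit Arguments.
Unset Strict Implicit.
Unset Printing Implicit Defensive.
Import Order.TTheory GRing.Theory Num.Theory.
Local Open Scope classical_set_scope.
Local Open Scope ring_scope.

(* [v] is only meaningful on nonzero elements; [val_ge v m x] is the usual
   inequality v(x) >= m, with the convention v(0) = +oo. *)
Definition val_ge (F : fieldType) (v : F -> int) (m : int) (x : F) : bool :=
  (x == 0) || (m <= v x).

(* A field complete for a normalized discrete valuation, with finite residue
   field: the finite list [s] below meets every residue class. *)
Record nonarch_local_field (F : fieldType) (v : F -> int) : Prop := {
  nalf_mul : forall x y, x != 0 -> y != 0 -> v (x * y) = v x + v y;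
  nalf_add : forall m x y, val_ge v m x -> val_ge v m y -> val_ge v m (x + y);
  nalf_uniformizer : exists2 x, x != 0 & v x = 1;
  nalf_residue : exists s : seq F,
    forall x, val_ge v 0 x -> exists2 a, a \in s & val_ge v 1 (x - a);
  nalf_complete : forall u : nat -> F,
    (forall m, exists N, forall i j, (N <= i)%N -> (N <= j)%N ->
       val_ge v m (u i - u j)) ->
    exists l, forall m, exists N, forall i, (N <= i)%N -> val_ge v m (u i - l)
}.

Definition algebraic_closure (F : fieldType) (K : closedFieldType)
    (iota : {rmorphism F -> K}) : Prop :=
  forall x : K, algebraicOver iota x.

Record Gm (k : fieldType) := MkGm { Gm_val :> k; Gm_neq0 : Gm_val != 0 }.
HB.instance Definition _ (k : fieldType) := [isSub for @Gm_val k].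
HB.instance Definition _ (k : fieldType) := [Choice of Gm k by <:].

Section GmGroup.
Variable k : fieldType.
Implicit Types x y z : Gm k.

Definition Gm_one : Gm k := MkGm (oner_neq0 k).
Definition Gm_mul x y : Gm k := MkGm (mulf_neq0 (Gm_neq0 x) (Gm_neq0 y)).
Definition Gm_inv x : Gm k := MkGm (invr_neq0 (Gm_neq0 x)).

Lemma Gm_mulA : associative Gm_mul.
Proof. by move=> x y z; apply: val_inj; rewrite /= mulrA. Qed.
Lemma Gm_mul1 : left_id Gm_one Gm_mul.
Proof. by move=> x; apply: val_inj; rewrite /= mul1r. Qed.
Lemma Gm_mulr1 : right_id Gm_one Gm_mul.
Proof. by move=> x; apply: val_inj; rewrite /= mulr1. Qed.
Lemma Gm_mulV : left_inverse Gm_one Gm_inv Gm_mul.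
Proof. by move=> x; apply: val_inj; rewrite /= mulVf ?Gm_neq0. Qed.
Lemma Gm_mulrV : right_inverse Gm_one Gm_inv Gm_mul.
Proof. by move=> x; apply: val_inj; rewrite /= mulfV ?Gm_neq0. Qed.

HB.instance Definition _ :=
  isGroup.Build (Gm k) Gm_mulA Gm_mul1 Gm_mulr1 Gm_mulV Gm_mulrV.

Lemma Gm_mulC x y : (x * y)%g = (y * x)%g.
Proof. by apply: val_inj; rewrite /= mulrC. Qed.
End GmGroup.

(* A linear algebraic group over F is given by its points over an algebraic
  closure K, as a closed subgroup of some GL_n(K) whose ideal is generated by
  polynomials with coefficients in F. *)

Section AlgebraicSets.
Variables (K : fieldType) (n : nat).
Implicit Types (g : 'M[K]_n) (X : set 'M[K]_n).

Definition mx_eval (p : {mpoly K[n * n]}) g : K := p.@[mxvec g 0].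

Definition GL_closed X : Prop :=
  exists P : set {mpoly K[n * n]},
    X = [set g | g \in unitmx /\ forall p, P p -> mx_eval p g = 0].

Definition algebraic_subgroup X : Prop :=
  [/\ GL_closed X, X 1%:M, forall x y, X x -> X y -> X (x *m y)
    & forall x, X x -> X (invmx x)].

Definition zariski_connected X : Prop :=
  forall Y Z, GL_closed Y -> GL_closed Z -> X = Y `|` Z -> Y `&` Z = set0 ->
    Y = set0 \/ Z = set0.

Definition normal_in X Y : Prop :=
  Y `<=` X /\ forall x y, X x -> Y y -> Y (x *m y *m invmx x).

Definition unipotent X : Prop := forall x, X x -> (x - 1%:M) ^+ n = 0.

Definition reductive X : Prop :=
  forall U, algebraic_subgroup U -> zariski_connected U -> unipotent U ->
    normal_in X U -> U = [set 1%:M].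

Definition group_center X : set 'M[K]_n :=
  [set z | X z /\ forall x, X x -> z *m x = x *m z].

Definition vanishing_ideal X : set {mpoly K[n * n]} :=
  [set p | forall g, X g -> mx_eval p g = 0].

Definition diag_group : set 'M[K]_n := [set g | g \in unitmx /\ is_diag_mx g].

End AlgebraicSets.

Section OverSubfield.
Variables (k K : fieldType) (j : {rmorphism k -> K}).

Definition defined_over n (X : set 'M[K]_n) : Prop :=
  forall p, vanishing_ideal X p ->
    exists2 s : seq ({mpoly K[n * n]} * {mpoly k[n * n]}),
      (forall q, q \in s -> vanishing_ideal X (map_mpoly j q.2))
      & p = \sum_(q <- s) q.1 * map_mpoly j q.2.

(* The coordinate ring of GL_m is the localization of the polynomial ring at
   the determinant, whence the power of det g. *)
Definition regular_over m n (X : set 'M[K]_m) (f : 'M[K]_m -> 'M[K]_n) : Prop :=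
  exists (e : nat) (P : 'I_n -> 'I_n -> {mpoly k[m * m]}),
    forall g, X g -> forall a b,
      (\det g) ^+ e * f g a b = mx_eval (map_mpoly j (P a b)) g.

Definition split_torus n (T : set 'M[K]_n) : Prop :=
  [/\ algebraic_subgroup T, defined_over T
    & exists (r : nat) (f : 'M[K]_r -> 'M[K]_n) (h : 'M[K]_n -> 'M[K]_r),
      [/\ regular_over (@diag_group K r) f /\ regular_over T h,
          (forall d, diag_group d -> T (f d) /\ h (f d) = d),
          (forall t, T t -> diag_group (h t) /\ f (h t) = t)
        & forall d d', diag_group d -> diag_group d' ->
            f (d *m d') = f d *m f d']].
End OverSubfield.

(* Over the algebraically closed field K every torus is split. *)
Definition torus (K : closedFieldType) n (T : set 'M[K]_n) : Prop :=
  split_torus (idfun : {rmorphism K -> K}) T.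

Definition maximal_torus (K : closedFieldType) n (G T : set 'M[K]_n) : Prop :=
  [/\ torus T, T `<=` G
    & forall T', torus T' -> T' `<=` G -> T `<=` T' -> T' = T].

Record split_reductive_group (F : fieldType) (K : closedFieldType)
    (iota : {rmorphism F -> K}) := SplitReductiveGroup {
  srg_dim : nat;
  srg_points :> set 'M[K]_srg_dim;
  srg_torus : set 'M[K]_srg_dim;
  srg_group : algebraic_subgroup srg_points;
  srg_defined : defined_over iota srg_points;
  srg_connected : zariski_connected srg_points;
  srg_reductive : reductive srg_points;
  srg_split : split_torus iota srg_torus;
  srg_maximal : maximal_torus srg_points srg_torus
}.

Arguments srg_points {F K iota} s _ : rename.
Arguments srg_torus {F K iota} s _ : rename.

(* Connectedness of the center as a scheme only depends on its K-points. *)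
Definition connected_center (F : fieldType) (K : closedFieldType)
    (iota : {rmorphism F -> K}) (G : split_reductive_group iota) : Prop :=
  zariski_connected (group_center G).

Lemma algebraic_subgroup_unit (K : fieldType) n (X : set 'M[K]_n) x :
  algebraic_subgroup X -> X x -> x \in unitmx.
Proof. by case=> -[P ->] _ _ _ []. Qed.

Section Cocharacters.
Variables (F : fieldType) (K : closedFieldType) (iota : {rmorphism F -> K}).
Variable G : split_reductive_group iota.
Local Notation n := (srg_dim G).
Local Notation T := (srg_torus G).
Implicit Types (x y g t : 'M[K]_n).

Lemma torus_subgroup : algebraic_subgroup T.
Proof. by case: (srg_split G). Qed.

Lemma torus_unit t : T t -> t \in unitmx.
Proof. exact: algebraic_subgroup_unit torus_subgroup. Qed.

Lemma torus1 : T 1%:M. Proof. by case: torus_subgroup. Qed.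

Lemma torusM x y : T x -> T y -> T (x *m y).
Proof. by case: torus_subgroup => _ _ + _; apply. Qed.

Lemma torusV x : T x -> T (invmx x).
Proof. by case: torus_subgroup => _ _ _; apply. Qed.

Lemma torusC x y : T x -> T y -> x *m y = y *m x.
Proof.
case: (srg_split G) => _ _ [r [f [h [_ _ hT fM]]]] /hT[dx ex] /hT[dy ey].
rewrite -ex -ey -!fM //; congr f.
case: dx dy => _ /is_diag_mxP dx [_ /is_diag_mxP dy].
apply/matrixP => a b; rewrite !mxE; apply: eq_bigr => c _.
have [<-|ac] := eqVneq a c; last first.
  by rewrite dx ?mul0r ?[h y a c]dy ?mul0r.
have [<-|ab] := eqVneq a b; first by rewrite mulrC.
by rewrite dy ?mulr0 ?[h x a b]dx ?mulr0.
Qed.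

(* A regular map on Gm = Spec K[z, z^-1] is a Laurent polynomial, here with
   matrix coefficients. *)
Definition laurent (f : Gm K -> 'M[K]_n) : Prop :=
  exists s : seq (int * 'M[K]_n),
    forall z, f z = \sum_(p <- s) (Gm_val z ^ p.1) *: p.2.

Record cocharacter := Cocharacter {
  cochar_fun :> Gm K -> 'M[K]_n;
  cochar_torus : forall z, T (cochar_fun z);
  cochar_mul : forall z z', cochar_fun (z * z')%g = cochar_fun z *m cochar_fun z';
  cochar_laurent : laurent cochar_fun
}.

HB.instance Definition _ := gen_eqMixin cocharacter.
HB.instance Definition _ := gen_choiceMixin cocharacter.

Lemma cochar_ext (a b : cocharacter) : (forall z, a z = b z) -> a = b.
Proof.
case: a b => [a a1 a2 a3] [b b1 b2 b3] /= /funext e; subst b.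
by congr Cocharacter; apply: Prop_irrelevance.
Qed.

Lemma cochar_unit (a : cocharacter) z : a z \in unitmx.
Proof. exact/torus_unit/cochar_torus. Qed.

Lemma cochar1 (a : cocharacter) : a 1%g = 1%:M.
Proof.
have u := cochar_unit a 1%g.
by rewrite -[LHS](mulKmx u) -cochar_mul mulg1 mulVmx.
Qed.

Lemma laurent_const g : laurent (fun=> g).
Proof. by exists [:: (0, g)] => z; rewrite big_seq1 /= expr0z scale1r. Qed.

Lemma laurentM f h : laurent f -> laurent h -> laurent (fun z => f z *m h z).
Proof.
move=> [s es] [s' es'].
exists [seq (p.1 + q.1, p.2 *m q.2) | p <- s, q <- s'] => z.
rewrite es es' big_allpairs_dep mulmx_suml; apply: eq_bigr => p _.
rewrite mulmx_sumr; apply: eq_bigr => q _ /=.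
by rewrite -scalemxAl -scalemxAr scalerA expfzDr ?Gm_neq0.
Qed.

Lemma laurentV f : laurent f -> laurent (fun z => f z^-1%g).
Proof.
move=> [s es]; exists [seq (- p.1, p.2) | p <- s] => z.
by rewrite es big_map; apply: eq_bigr => p _ /=; rewrite exprz_inv.
Qed.

Lemma cochar_add_mul (a b : cocharacter) z z' :
  a (z * z')%g *m b (z * z')%g = (a z *m b z) *m (a z' *m b z').
Proof.
rewrite !cochar_mul !mulmxA; congr (_ *m _); rewrite -!mulmxA; congr (_ *m _).
by apply: torusC; apply: cochar_torus.
Qed.

Definition cochar_add (a b : cocharacter) : cocharacter :=
  @Cocharacter (fun z => a z *m b z)
    (fun z => torusM (cochar_torus a z) (cochar_torus b z))
    (cochar_add_mul a b) (laurentM (cochar_laurent a) (cochar_laurent b)).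

Lemma cochar_zero_mul (z z' : Gm K) : 1%:M = 1%:M *m 1%:M :> 'M[K]_n.
Proof. by rewrite mulmx1. Qed.

Definition cochar_zero : cocharacter :=
  @Cocharacter (fun=> 1%:M) (fun=> torus1) cochar_zero_mul (laurent_const _).

Lemma cochar_opp_mul (a : cocharacter) z z' :
  a (z * z')^-1%g = a z^-1%g *m a z'^-1%g.
Proof. by rewrite invgM cochar_mul torusC //; apply: cochar_torus. Qed.

Definition cochar_opp (a : cocharacter) : cocharacter :=
  @Cocharacter (fun z => a z^-1%g) (fun z => cochar_torus a z^-1%g)
    (cochar_opp_mul a) (laurentV (cochar_laurent a)).

Lemma cochar_addA : associative cochar_add.
Proof. by move=> a b c; apply: cochar_ext => z; rewrite /= mulmxA. Qed.
Lemma cochar_addC : commutative cochar_add.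
Proof. by move=> a b; apply: cochar_ext => z; apply: torusC; apply: cochar_torus. Qed.
Lemma cochar_add0 : left_id cochar_zero cochar_add.
Proof. by move=> a; apply: cochar_ext => z; rewrite /= mul1mx. Qed.
Lemma cochar_addN : left_inverse cochar_zero cochar_opp cochar_add.
Proof.
by move=> a; apply: cochar_ext => z; rewrite /= -cochar_mul mulVg cochar1.
Qed.

HB.instance Definition _ :=
  GRing.isZmodule.Build cocharacter cochar_addA cochar_addC cochar_add0 cochar_addN.

Definition normalizer : set 'M[K]_n :=
  [set g | srg_points G g /\ [set g *m t *m invmx g | t in T] = T].

Definition torus_coset g : set 'M[K]_n := [set g *m t | t in T].

(* N_G(T) / T, an element being a coset gT viewed as a set of matrices. *)
Record weyl := Weyl {
  weyl_set :> set 'M[K]_n;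
  weylP : exists2 g, normalizer g & weyl_set = torus_coset g
}.

Arguments weyl_set : clear implicits.
HB.instance Definition _ := gen_eqMixin weyl.
HB.instance Definition _ := gen_choiceMixin weyl.

Lemma weyl_ext (u w : weyl) : weyl_set u = weyl_set w -> u = w.
Proof.
case: u w => [u u1] [w w1] /= e; subst w.
by congr Weyl; apply: Prop_irrelevance.
Qed.

Lemma normalizer_unit g : normalizer g -> g \in unitmx.
Proof. by case=> Gg _; apply: algebraic_subgroup_unit (srg_group G) Gg. Qed.

Lemma normalizer_conj g t : normalizer g -> T t -> T (g *m t *m invmx g).
Proof. by case=> _ /seteqP[+ _] Tt; apply; exists t. Qed.

Lemma normalizer_conjV g t : normalizer g -> T t -> T (invmx g *m t *m g).
Proof.
move=> Ng; have u := normalizer_unit Ng; case: Ng => _ /seteqP[_ +] Tt.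
move=> /(_ t Tt)[t' Tt' <-].
by rewrite -!mulmxA mulVmx // mulmx1 mulKmx.
Qed.

Lemma normalizerP g : srg_points G g -> (forall t, T t -> T (g *m t *m invmx g)) ->
  (forall t, T t -> T (invmx g *m t *m g)) -> normalizer g.
Proof.
move=> Gg c1 c2; have u := algebraic_subgroup_unit (srg_group G) Gg.
split=> //; apply/seteqP; split=> [_ [t Tt <-]|t Tt]; first exact: c1.
by exists (invmx g *m t *m g); rewrite ?mulmxA ?mulmxV ?mul1mx ?mulmxK //; apply: c2.
Qed.


Lemma invmxM x y : x \in unitmx -> y \in unitmx ->
  invmx (x *m y) = invmx y *m invmx x.
Proof.
move=> ux uy; have uxy : x *m y \in unitmx by rewrite unitmx_mul ux.
have e : invmx y *m invmx x *m (x *m y) = 1%:M.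
  by rewrite -mulmxA mulKmx // mulVmx.
by rewrite -[RHS](mulmxK uxy) e mul1mx.
Qed.

Lemma normalizer1 : normalizer 1%:M.
Proof.
apply: normalizerP => [|t Tt|t Tt]; first by case: (srg_group G).
  by rewrite invmx1 mul1mx mulmx1.
by rewrite invmx1 mul1mx mulmx1.
Qed.

Lemma normalizerM x y : normalizer x -> normalizer y -> normalizer (x *m y).
Proof.
move=> Nx Ny; have [ux uy] := (normalizer_unit Nx, normalizer_unit Ny).
apply: normalizerP => [|t Tt|t Tt].
- by case: (srg_group G) => _ _ + _; apply; [case: Nx|case: Ny].
- have := normalizer_conj Nx (normalizer_conj Ny Tt).
  by rewrite invmxM // !mulmxA.
- have := normalizer_conjV Ny (normalizer_conjV Nx Tt).
  by rewrite invmxM // !mulmxA.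
Qed.

Lemma normalizerV x : normalizer x -> normalizer (invmx x).
Proof.
move=> Nx; apply: normalizerP => [|t Tt|t Tt].
- by case: (srg_group G) => _ _ _; apply; case: Nx.
- by rewrite invmxK; apply: normalizer_conjV.
- by rewrite invmxK; apply: normalizer_conj.
Qed.

Lemma torus_coset_refl g : torus_coset g g.
Proof. by exists 1%:M; [exact: torus1|rewrite mulmx1]. Qed.

Lemma torus_coset_eq x y : x \in unitmx -> torus_coset x y ->
  torus_coset y = torus_coset x.
Proof.
move=> ux [t Tt <-]; have ut := torus_unit Tt.
apply/seteqP; split=> [_ [s Ts <-]|_ [s Ts <-]].
  by exists (t *m s); [exact: torusM|rewrite mulmxA].
exists (invmx t *m s); first exact: torusM (torusV Tt) Ts.
by rewrite mulmxA mulmxK.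
Qed.

Lemma torus_cosetM x y : normalizer x -> normalizer y ->
  [set a *m b | a in torus_coset x & b in torus_coset y] = torus_coset (x *m y).
Proof.
move=> Nx Ny; have uy := normalizer_unit Ny.
apply/seteqP; split=> [_ [_ [s Ts <-] [_ [t Tt <-] <-]]|_ [t Tt <-]].
  exists (invmx y *m s *m y *m t); first exact: torusM (normalizer_conjV Ny Ts) Tt.
  by rewrite !mulmxA mulmxK.
exists x; first exact: torus_coset_refl.
by exists (y *m t); [exists t|rewrite mulmxA].
Qed.

Lemma torus_cosetV x : normalizer x ->
  [set invmx a | a in torus_coset x] = torus_coset (invmx x).
Proof.
move=> Nx; have ux := normalizer_unit Nx.
apply/seteqP; split=> [_ [_ [t Tt <-] <-]|_ [t Tt <-]].
  exists (x *m invmx t *m invmx x); first exact: normalizer_conj Nx (torusV Tt).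
  by rewrite invmxM ?(torus_unit Tt) // !mulmxA mulVmx // mul1mx.
exists (x *m (invmx x *m invmx t *m x)).
  by exists (invmx x *m invmx t *m x) => //; exact: normalizer_conjV Nx (torusV Tt).
have uit : invmx t \in unitmx by rewrite unitmx_inv torus_unit.
by rewrite !mulmxA mulmxV // mul1mx invmxM // invmxK.
Qed.

Lemma weyl_mul_subproof (u w : weyl) :
  exists2 g, normalizer g & [set a *m b | a in u & b in w] = torus_coset g.
Proof.
case: (weylP u) (weylP w) => [x Nx ->] [y Ny ->].
by exists (x *m y); [exact: normalizerM|exact: torus_cosetM].
Qed.
Definition weyl_mul (u w : weyl) : weyl := Weyl (weyl_mul_subproof u w).

Lemma weyl_inv_subproof (w : weyl) :
  exists2 g, normalizer g & [set invmx a | a in w] = torus_coset g.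
Proof.
by case: (weylP w) => [x Nx ->]; exists (invmx x);
  [exact: normalizerV|exact: torus_cosetV].
Qed.
Definition weyl_inv (w : weyl) : weyl := Weyl (weyl_inv_subproof w).

Lemma weyl_one_subproof : exists2 g, normalizer g & T = torus_coset g.
Proof.
exists 1%:M; first exact: normalizer1.
by apply/seteqP; split=> [t Tt|_ [t Tt <-]]; rewrite ?mul1mx //;
  exists t; rewrite ?mul1mx.
Qed.
Definition weyl_one : weyl := Weyl weyl_one_subproof.

Definition weyl_class g (Ng : normalizer g) : weyl :=
  Weyl (ex_intro2 _ _ g Ng erefl).

Lemma weyl_classP (w : weyl) : exists g (Ng : normalizer g), w = weyl_class Ng.
Proof. by case: (weylP w) => g Ng e; exists g, Ng; apply: weyl_ext. Qed.

Lemma weyl_class_eq x y (Nx : normalizer x) (Ny : normalizer y) :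
  x = y -> weyl_class Nx = weyl_class Ny.
Proof. by move=> e; apply: weyl_ext; rewrite /= e. Qed.

Lemma weyl_class_mul x y (Nx : normalizer x) (Ny : normalizer y) :
  weyl_mul (weyl_class Nx) (weyl_class Ny) = weyl_class (normalizerM Nx Ny).
Proof. by apply: weyl_ext; exact: torus_cosetM. Qed.

Lemma weyl_class_inv x (Nx : normalizer x) :
  weyl_inv (weyl_class Nx) = weyl_class (normalizerV Nx).
Proof. by apply: weyl_ext; exact: torus_cosetV. Qed.

Lemma weyl_class_one : weyl_one = weyl_class normalizer1.
Proof.
apply: weyl_ext => /=; apply/seteqP; split=> [t Tt|_ [t Tt <-]]; rewrite ?mul1mx //.
by exists t; rewrite ?mul1mx.
Qed.

Lemma weyl_mulA : associative weyl_mul.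
Proof.
move=> u v w; case: (weyl_classP u) (weyl_classP v) (weyl_classP w) =>
  [x [Nx ->]] [y [Ny ->]] [z [Nz ->]].
by rewrite !weyl_class_mul; apply: weyl_class_eq; rewrite mulmxA.
Qed.
Lemma weyl_mul1 : left_id weyl_one weyl_mul.
Proof.
move=> u; case: (weyl_classP u) => [x [Nx ->]].
by rewrite weyl_class_one weyl_class_mul; apply: weyl_class_eq; rewrite mul1mx.
Qed.
Lemma weyl_mulr1 : right_id weyl_one weyl_mul.
Proof.
move=> u; case: (weyl_classP u) => [x [Nx ->]].
by rewrite weyl_class_one weyl_class_mul; apply: weyl_class_eq; rewrite mulmx1.
Qed.
Lemma weyl_mulV : left_inverse weyl_one weyl_inv weyl_mul.
Proof.
move=> u; case: (weyl_classP u) => [x [Nx ->]].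
rewrite weyl_class_one weyl_class_inv weyl_class_mul; apply: weyl_class_eq.
by rewrite mulVmx ?(normalizer_unit Nx).
Qed.
Lemma weyl_mulrV : right_inverse weyl_one weyl_inv weyl_mul.
Proof.
move=> u; case: (weyl_classP u) => [x [Nx ->]].
rewrite weyl_class_one weyl_class_inv weyl_class_mul; apply: weyl_class_eq.
by rewrite mulmxV ?(normalizer_unit Nx).
Qed.

HB.instance Definition _ :=
  isGroup.Build weyl weyl_mulA weyl_mul1 weyl_mulr1 weyl_mulV weyl_mulrV.

Definition weyl_rep (w : weyl) : 'M[K]_n := s2val (cid2 (weylP w)).

Lemma weyl_rep_normalizer w : normalizer (weyl_rep w).
Proof. exact: s2valP (cid2 (weylP w)). Qed.

Lemma weyl_repP (w : weyl) : weyl_set w (weyl_rep w).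
Proof. rewrite (s2valP' (cid2 (weylP w))); exact: torus_coset_refl. Qed.

Lemma laurent_conj g (f : Gm K -> 'M[K]_n) :
  laurent f -> laurent (fun z => g *m f z *m invmx g).
Proof.
by move=> lf; apply: laurentM (laurent_const _); apply: laurentM lf;
  apply: laurent_const.
Qed.

Lemma weyl_act_mul (w : weyl) (nu : cocharacter) z z' (g := weyl_rep w) :
  g *m nu (z * z')%g *m invmx g =
  (g *m nu z *m invmx g) *m (g *m nu z' *m invmx g).
Proof.
by rewrite cochar_mul !mulmxA mulmxKV // (normalizer_unit (weyl_rep_normalizer w)).
Qed.

(* By [weyl_actE] below, the choice of a representative is immaterial. *)
Definition weyl_act (w : weyl) (nu : cocharacter) : cocharacter :=
  @Cocharacter (fun z => weyl_rep w *m nu z *m invmx (weyl_rep w))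
    (fun z => normalizer_conj (weyl_rep_normalizer w) (cochar_torus nu z))
    (weyl_act_mul w nu) (laurent_conj _ (cochar_laurent nu)).

Lemma weyl_actE (w : weyl) (nu : cocharacter) g z :
  weyl_set w g -> weyl_act w nu z = g *m nu z *m invmx g.
Proof.
rewrite /= (s2valP' (cid2 (weylP w))) -/(weyl_rep w) => -[t Tt <-].
have ut := torus_unit Tt; have ur := normalizer_unit (weyl_rep_normalizer w).
rewrite invmxM // -(mulmxA _ t) (torusC Tt (cochar_torus nu z)).
by rewrite !mulmxA mulmxK.
Qed.

Lemma weyl_act1 (nu : cocharacter) : weyl_act 1%g nu = nu.
Proof.
apply: cochar_ext => z; rewrite (@weyl_actE _ _ 1%:M); last exact: torus1.
by rewrite invmx1 mul1mx mulmx1.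
Qed.

Lemma weyl_set_unit (w : weyl) g : weyl_set w g -> g \in unitmx.
Proof.
case: (weylP w) => x Nx -> [t Tt <-].
by rewrite unitmx_mul (normalizer_unit Nx) torus_unit.
Qed.

Lemma weyl_actM (u w : weyl) (nu : cocharacter) :
  weyl_act (u * w)%g nu = weyl_act u (weyl_act w nu).
Proof.
apply: cochar_ext => z; have [ru rw] := (weyl_repP u, weyl_repP w).
rewrite (@weyl_actE _ _ (weyl_rep u *m weyl_rep w)); last first.
  by exists (weyl_rep u) => //; exists (weyl_rep w).
rewrite (weyl_actE _ _ ru) (weyl_actE _ _ rw) invmxM ?(weyl_set_unit ru) //.
  by rewrite !mulmxA.
exact: weyl_set_unit rw.
Qed.

Lemma weyl_actD (w : weyl) : {morph weyl_act w : a b / a + b}.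
Proof.
move=> a b; apply: cochar_ext => z /=.
by rewrite !mulmxA mulmxKV // (normalizer_unit (weyl_rep_normalizer w)).
Qed.

Record ext_weyl := ExtWeyl { translation : cocharacter; finite_part : weyl }.

HB.instance Definition _ := gen_eqMixin ext_weyl.
HB.instance Definition _ := gen_choiceMixin ext_weyl.

Definition ext_weyl_mul (x y : ext_weyl) : ext_weyl :=
  ExtWeyl (translation x + weyl_act (finite_part x) (translation y))
          (finite_part x * finite_part y)%g.
Definition ext_weyl_one : ext_weyl := ExtWeyl 0 1%g.
Definition ext_weyl_inv (x : ext_weyl) : ext_weyl :=
  ExtWeyl (weyl_act (finite_part x)^-1%g (- translation x)) (finite_part x)^-1%g.

Lemma weyl_act0 w : weyl_act w 0 = 0.
Proof. by apply: (addrI (weyl_act w 0)); rewrite -weyl_actD !addr0. Qed.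

Lemma ext_weyl_mulA : associative ext_weyl_mul.
Proof.
by move=> x y z; rewrite /ext_weyl_mul /= weyl_actD weyl_actM addrA mulgA.
Qed.
Lemma ext_weyl_mul1 : left_id ext_weyl_one ext_weyl_mul.
Proof. by case=> l w; rewrite /ext_weyl_mul /= weyl_act1 add0r mul1g. Qed.
Lemma ext_weyl_mulr1 : right_id ext_weyl_one ext_weyl_mul.
Proof. by case=> l w; rewrite /ext_weyl_mul /= weyl_act0 addr0 mulg1. Qed.
Lemma ext_weyl_mulV : left_inverse ext_weyl_one ext_weyl_inv ext_weyl_mul.
Proof.
by case=> l w; rewrite /ext_weyl_mul /= -weyl_actD addNr weyl_act0 mulVg.
Qed.
Lemma ext_weyl_mulrV : right_inverse ext_weyl_one ext_weyl_inv ext_weyl_mul.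
Proof.
by case=> l w; rewrite /ext_weyl_mul /= -weyl_actM mulgV weyl_act1 addrN.
Qed.

HB.instance Definition _ :=
  isGroup.Build ext_weyl ext_weyl_mulA ext_weyl_mul1 ext_weyl_mulr1
    ext_weyl_mulV ext_weyl_mulrV.

Definition ext_translation (l : cocharacter) : ext_weyl := ExtWeyl l 1%g.
Definition ext_finite (u : weyl) : ext_weyl := ExtWeyl 0 u.

Lemma ext_weylE (w : ext_weyl) :
  w = (ext_translation (translation w) * ext_finite (finite_part w))%g.
Proof.
case: w => l u; rewrite /ext_translation /ext_finite /GRing.zero.
by congr ExtWeyl => /=; rewrite ?weyl_act0 ?addr0 ?mul1g.
Qed.

End Cocharacters.

(* The torus over k with character group X: its points are the homomorphisms
   from X to the units of k; its coordinate ring is the group algebra k[X], an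
   element of which is given below as a list of (coefficient, character). *)
Record dual_torus (k : fieldType) (X : zmodType) := DualTorus {
  dual_fun :> X -> Gm k;
  dual_funD : {morph dual_fun : a b / a + b >-> (a * b)%g}
}.

HB.instance Definition _ k X := gen_eqMixin (dual_torus k X).
HB.instance Definition _ k X := gen_choiceMixin (dual_torus k X).

Section DualTorusGroup.
Variables (k : fieldType) (X : zmodType).
Local Notation D := (dual_torus k X).
Implicit Types kappa : D.

Lemma dual_ext (kappa kappa' : D) :
  (forall nu, kappa nu = kappa' nu) -> kappa = kappa'.
Proof.
case: kappa kappa' => [f f1] [h h1] /= /funext e; subst h.
by congr DualTorus; apply: Prop_irrelevance.
Qed.

Lemma dual_one_morph : {morph (fun=> 1%g : Gm k) : a b / (a : X) + b >-> (a * b)%g}.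
Proof. by move=> a b; rewrite mulg1. Qed.
Definition dual_one : D := DualTorus dual_one_morph.

Lemma dual_mul_morph kappa kappa' :
  {morph (fun nu => (kappa nu * kappa' nu)%g) : a b / a + b >-> (a * b)%g}.
Proof.
move=> a b; rewrite !dual_funD -!mulgA; congr (_ * _)%g.
by rewrite !mulgA; congr (_ * _)%g; rewrite Gm_mulC.
Qed.
Definition dual_mul kappa kappa' : D := DualTorus (dual_mul_morph kappa kappa').

Lemma dual_inv_morph kappa :
  {morph (fun nu => (kappa nu)^-1%g) : a b / a + b >-> (a * b)%g}.
Proof. by move=> a b; rewrite dual_funD invgM Gm_mulC. Qed.
Definition dual_inv kappa : D := DualTorus (dual_inv_morph kappa).

Lemma dual_mulA : associative dual_mul.
Proof. by move=> a b c; apply: dual_ext => nu; rewrite /= mulgA. Qed.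
Lemma dual_mul1 : left_id dual_one dual_mul.
Proof. by move=> a; apply: dual_ext => nu; rewrite /= mul1g. Qed.
Lemma dual_mulr1 : right_id dual_one dual_mul.
Proof. by move=> a; apply: dual_ext => nu; rewrite /= mulg1. Qed.
Lemma dual_mulV : left_inverse dual_one dual_inv dual_mul.
Proof. by move=> a; apply: dual_ext => nu; rewrite /= mulVg. Qed.
Lemma dual_mulrV : right_inverse dual_one dual_inv dual_mul.
Proof. by move=> a; apply: dual_ext => nu; rewrite /= mulgV. Qed.

HB.instance Definition _ :=
  isGroup.Build D dual_mulA dual_mul1 dual_mulr1 dual_mulV dual_mulrV.

Definition dual_closed (S : set D) : Prop :=
  exists P : set (seq (k * X)),
    S = [set kappa | forall s, P s ->
           \sum_(p <- s) p.1 * Gm_val (kappa p.2) = 0].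
End DualTorusGroup.

Definition is_subgroup (H : groupType) (S : set H) : Prop :=
  [/\ S 1%g, forall x y, S x -> S y -> S (x * y)%g
    & forall x, S x -> S x^-1%g].

Section Relevant.
Variables (F : fieldType) (K : closedFieldType) (iota : {rmorphism F -> K}).
Variables (G : split_reductive_group iota) (k : fieldType).
Local Notation X := (cocharacter G).

Lemma weyl_dual_morph (u : weyl G) (kappa : dual_torus k X) :
  {morph (fun nu => kappa (weyl_act u^-1%g nu)) : a b / a + b >-> (a * b)%g}.
Proof. by move=> a b; rewrite weyl_actD dual_funD. Qed.

Definition weyl_dual_act (u : weyl G) (kappa : dual_torus k X) : dual_torus k X :=
  DualTorus (weyl_dual_morph u kappa).

Lemma weyl_dual_actE (u : weyl G) (nu : X) (kappa : dual_torus k X) :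
  kappa (weyl_act u nu) = weyl_dual_act u^-1%g kappa nu.
Proof. by rewrite /= invgK. Qed.

Definition relevant (w : ext_weyl G) (kappa : dual_torus k X) : Prop :=
  weyl_dual_act (finite_part w) kappa = kappa /\ kappa (translation w) = 1%g.
End Relevant.

(* Main.v *)
(* With $X$ the character group of the torus, relevance to $t_\lambda \bar w$
   says that $\kappa$ takes the same value on the two characters of each of the
   pairs $(\bar w^{-1}\nu, \nu)$, for $\nu \in X$, and $(\lambda, 0)$. Such
   conditions cut out a subgroup because $\kappa \mapsto \kappa(a)$ is
   multiplicative, and a closed set because they are the binomial equations
   $a - b = 0$ in $k[X]$. *)

Require Import Defs.
From HB Require Import structures.
From mathcomp Require Import all_boot all_order all_algebra.
From mathcomp Require Import boolp classical_sets reals complex mpoly.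
Set Implicit Arguments.
Unset Strict Implicit.
Unset Printing Implicit Defensive.
Import Order.TTheory GRing.Theory Num.Theory.
Local Open Scope classical_set_scope.
Local Open Scope ring_scope.

(** Lets the condition at $\lambda$, a value equal to 1, be read as an equality between two values
    of [kappa]. *)
Lemma dual_fun0 (k : fieldType) (X : zmodType) (kappa : dual_torus k X) :
  kappa 0 = 1%g.
Proof. by apply: (mulgI (kappa 0)); rewrite -dual_funD addr0 mulg1. Qed.

Definition dual_equalizer (k : fieldType) (X : zmodType) (E : set (X * X)) :
    set (dual_torus k X) :=
  [set kappa | forall p, E p -> kappa p.1 = kappa p.2].

Lemma dual_equalizer_subgroup (k : fieldType) (X : zmodType) (E : set (X * X)) :
  is_subgroup (@dual_equalizer k X E).
Proof.
split=> [//|x y Sx Sy|x Sx] p Ep /=; first by rewrite Sx ?Sy.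
by rewrite Sx.
Qed.

Lemma dual_equalizer_closed (k : fieldType) (X : zmodType) (E : set (X * X)) :
  dual_closed (@dual_equalizer k X E).
Proof.
have binomial (kappa : dual_torus k X) (p : X * X) :
    \sum_(q <- [:: (1, p.1); (-1, p.2)]) q.1 * Gm_val (kappa q.2) =
    Gm_val (kappa p.1) - Gm_val (kappa p.2).
  by rewrite big_cons big_seq1 /= mul1r mulN1r.
exists [set [:: (1, p.1); (-1, p.2)] | p in E].
apply/seteqP; split=> [kappa Sk _ [p Ep <-]|kappa Sk p Ep].
  by rewrite binomial Sk ?subrr.
(* Points of [Gm k] agree once their scalars do, so a vanishing binomial in [k] suffices. *)
by apply/val_inj/eqP; rewrite -subr_eq0 -binomial; apply/eqP/Sk; exists p.
Qed.

(** The inverse comes from the dual action $(\bar w\kappa)(\nu) = \kappa(\bar w^{-1}\nu)$. *)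
Definition relevant_pairs (F : fieldType) (K : closedFieldType)
    (iota : {rmorphism F -> K}) (G : split_reductive_group iota)
    (w : ext_weyl G) : set (cocharacter G * cocharacter G) :=
  (translation w, 0) |` range (fun nu => (weyl_act (finite_part w)^-1%g nu, nu)).

Lemma relevantE (F : fieldType) (K : closedFieldType)
    (iota : {rmorphism F -> K}) (G : split_reductive_group iota)
    (k : fieldType) (w : ext_weyl G) :
  [set kappa : dual_torus k (cocharacter G) | relevant w kappa] =
  dual_equalizer (relevant_pairs w).
Proof.
apply/seteqP; split=> [kappa [wk lk] p|kappa Sk].
  (* Only the right-hand [kappa] becomes its Weyl translate, whose value at [nu] is by definition
     the left-hand side. *)
  by case=> [->|[nu _ <-]] /=; rewrite ?dual_fun0 // -{2}wk.
split; last by rewrite -(dual_fun0 kappa); apply: (Sk (translation w, 0)); left.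
apply: dual_ext => nu.
by apply: (Sk (weyl_act (finite_part w)^-1%g nu, nu)); right; exists nu.
Qed.

Theorem proposition3p11
    (F : fieldType) (v : F -> int) (hF : nonarch_local_field v)
    (K : closedFieldType) (iota : {rmorphism F -> K})
    (hK : algebraic_closure iota)
    (G : split_reductive_group iota) (hG : connected_center G)
    (R : realType) (w : ext_weyl G) :
  let S_w : set (dual_torus R[i] (cocharacter G)) :=
    [set kappa | relevant w kappa] in
  is_subgroup S_w /\ dual_closed S_w.
Proof.
rewrite /= relevantE.
by split; [exact: dual_equalizer_subgroup|exact: dual_equalizer_closed].
Qed.
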